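(* Let $R$ be a ring and let $n\in \mathbb{N}$. Then the following are equivalent: (1) $R$ is strongly $(x^2-2^{n}x)$-clean. (2) $R$ is strongly $(x^2-1)$-clean. (3) $R$ is strongly clean and $2\in U(R)$. (4) $R=U_{2}(R)$ and every $a\in R$ can be expressed as $a=u+v$ with some $u,v\in U(R)$ such that $uv=vu$ and $v^{2}=1$.
   Context: Rings are associative with identity (not necessarily commutative). $\mathbb{N}$ is the set of positive integers. $U(R)$ denotes the group of units of $R$ and $C(R)$ the center of $R$. For $g(x)\in C(R)[x]$, the ring $R$ is called strongly $g(x)$-clean if every $r\in R$ can be written as $r=s+u$ with $s\in R$, $g(s)=0$, $u\in U(R)$, and $su=us$ (integer coefficients are interpreted via their images in $C(R)$). $R$ is called strongly clean if every $r\in R$ can be written as $r=e+u$ with $e^2=e\in R$, $u\in U(R)$, and $eu=ue$. $U_{2}(R)$ denotes the set of elements of $R$ which can be written as a sum of no more than $2$ units of $R$. *)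

(* Defs.v *)
From mathcomp Require Import all_boot all_order all_algebra.

Set Implicit Arguments.
Unset Strict Implicit.
Unset Printing Implicit Defensive.

Import GRing.Theory.
Local Open Scope ring_scope.

(* [pzRingType] is an arbitrary associative ring with identity, the zero      *)
(* ring included.  [{poly R}] and [GRing.unit] both require [1 != 0] in R     *)
(* (and the latter a boolean unit predicate), hence the definitions below.    *)

Section CleanRings.
Variable R : pzRingType.
Implicit Types (r s u v e c : R).

Definition is_unit u : Prop := exists v, v * u = 1 /\ u * v = 1.

Definition is_central c : Prop := forall r, GRing.comm c r.

(* C(R)[x]: coefficient lists, constant term first; trailing zeros are        *)
(* allowed, so a polynomial may have several representatives.                 *)
Record central_poly := CentralPoly {
  central_coefs : seq R;
  central_coefsP : forall c, c \in central_coefs -> is_central c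
}.

Definition central_eval (g : central_poly) s : R :=
  \sum_(i < size (central_coefs g)) (central_coefs g)`_i * s ^+ i.

Definition strongly_poly_clean (g : central_poly) : Prop :=
  forall r, exists s u,
    [/\ r = s + u, central_eval g s = 0, is_unit u & GRing.comm s u].

Definition strongly_clean : Prop :=
  forall r, exists e u,
    [/\ r = e + u, e ^+ 2 = e, is_unit u & GRing.comm e u].

(* The empty sum is allowed, which is harmless for k >= 2: 0 = 1 + (-1).      *)
Definition sum_of_units_le (k : nat) r : Prop :=
  exists us : seq R,
    [/\ (size us <= k)%N, forall u, u \in us -> is_unit u
      & r = \sum_(u <- us) u].

Fact intr_coefs_central (p : {poly int}) c :
  c \in [seq a%:~R | a <- p] -> is_central c.
Proof. by case/mapP=> a _ -> r; apply/esym/commr_int. Qed.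

Definition int_central_poly (p : {poly int}) : central_poly :=
  CentralPoly (@intr_coefs_central p).

End CleanRings.

Arguments strongly_clean R : clear implicits.
Arguments int_central_poly R p : clear implicits.

(* Main.v *)
Require Import Defs.
From mathcomp Require Import all_boot all_order all_algebra.

Import GRing.Theory.
Local Open Scope ring_scope.

(** All four conditions ask that every element be the sum of a unit and of a
    commuting root of a quadratic equation: [s ^+ 2 = 2 ^+ n * s],
    [s ^+ 2 = 1] or [s ^+ 2 = s].  If [2] is invertible, affine substitutions
    [s |-> c * s + d] with [c] and [d] central and [c] a unit carry the roots
    of the first equation to those of the second, the roots of the second to
    those of the other two, and idempotents to roots of the second; such a
    substitution preserves the existence of decompositions
    ([root_clean_affine]).  The last condition repeats the one for
    [s ^+ 2 = 1], whose decompositions are already sums of two units.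

    Invertibility of [2] comes from decomposing one well-chosen element.  In
    [0 = s + u] the root [s = - u] is a unit, so [s ^+ 2 = 2 ^+ n * s] forces
    [s = 2 ^+ n].  In [1 = s + u] with [s ^+ 2 = 1], the unit [u = 1 - s]
    satisfies [u * (1 + s) = 0], so that [s = - 1] and [u = 2].  *)

Section Units.
Variable R : pzRingType.
Implicit Types (a b c k s u v : R).

Lemma is_unit_mul u v : is_unit u -> is_unit v -> is_unit (u * v).
Proof.
case=> [u' [u'u uu']] [v' [v'v vv']]; exists (v' * u'); split.
  by rewrite mulrA -(mulrA v') u'u mulr1.
by rewrite mulrA -(mulrA u) vv' mulr1.
Qed.

Lemma is_unit_opp u : is_unit u -> is_unit (- u).
Proof. by case=> v [vu uv]; exists (- v); rewrite !mulrNN. Qed.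

Lemma is_unit_sqr1 v : v ^+ 2 = 1 -> is_unit v.
Proof. by rewrite expr2 => vv; exists v. Qed.

Lemma is_unit_mulI u a b : is_unit u -> u * a = u * b -> a = b.
Proof. by case=> v [vu _] uab; rewrite -[a]mul1r -vu -mulrA uab mulrA vu mul1r. Qed.

Lemma is_unit_expr_gt0 a n : (0 < n)%N -> is_unit (a ^+ n) -> is_unit a.
Proof.
case: n => // n _ [b [ba ab]].
have right_inv : a * (a ^+ n * b) = 1 by rewrite mulrA -exprS.
have left_inv : (b * a ^+ n) * a = 1 by rewrite -mulrA -exprSr.
exists (b * a ^+ n); split=> //.
by rewrite -[b * _]mulr1 -right_inv (mulrA (b * _)) left_inv mul1r right_inv.
Qed.

Lemma is_central_nat n : is_central (n%:R : R).
Proof. by move=> r; apply/esym/commr_nat. Qed.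

Lemma is_central_opp c : is_central c -> is_central (- c).
Proof. by move=> cC r; apply/commr_sym/commrN/commr_sym/cC. Qed.

Lemma is_central_expr c m : is_central c -> is_central (c ^+ m).
Proof. by move=> cC r; apply/commr_sym/commrX/commr_sym/cC. Qed.

Lemma is_central_inv c k : k * c = 1 -> c * k = 1 -> is_central c -> is_central k.
Proof.
move=> kc ck cC r; rewrite /GRing.comm.
by rewrite -[k * r]mulr1 -ck mulrA -(mulrA k) -cC mulrA kc mul1r.
Qed.

Lemma sqr_affine c d s : is_central c -> is_central d ->
  (c * s + d) ^+ 2 = c ^+ 2 * s ^+ 2 + (d * c * s) *+ 2 + d ^+ 2.
Proof.
move=> cC dC; rewrite expr2 mulrDl !mulrDr -(dC (c * s)) -!expr2.
by rewrite (exprMn_comm _ (cC s)) -!mulrA mulr2n !addrA.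
Qed.

Lemma mulr_exp2 m s : 2%:R ^+ m.+1 * s = (2%:R ^+ m * s) *+ 2.
Proof. by rewrite exprS -mulrA mulr_natl. Qed.

End Units.

Section Evaluation.
Variable R : pzRingType.
Implicit Type s : R.

Lemma central_eval_widen (p : {poly int}) (m : nat) s : (size p <= m)%N ->
  central_eval (int_central_poly R p) s = \sum_(i < m) (p`_i)%:~R * s ^+ i.
Proof.
move=> le_pm; rewrite /central_eval /= size_map.
rewrite (big_ord_widen m (fun i => _`_i * s ^+ i) le_pm) big_mkcond /=.
apply: eq_bigr => i _; case: ltnP => [lt_ip | le_pi].
  by rewrite (nth_map 0).
by rewrite nth_default // mul0r.
Qed.

Lemma central_eval_X2_sub_exp2X n s :
  central_eval (int_central_poly R ('X^2 - (2 ^+ n) *: 'X)) s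
    = s ^+ 2 - 2%:R ^+ n * s.
Proof.
rewrite (@central_eval_widen _ 3) => [|]; last first.
  rewrite (leq_trans (size_polyD _ _)) // geq_max size_polyXn size_polyN /=.
  by rewrite (leq_trans (size_scale_leq _ _)) // size_polyX.
rewrite !big_ord_recl big_ord0 /= !coefB !coefZ !coefXn !coefX /=.
rewrite !mulr0 !subr0 !mulr1 sub0r mulr0z mulr1z mul1r add0r addr0 expr1.
by rewrite addrC mulrNz mulNr rmorphXn.
Qed.

Lemma central_eval_X2_sub1 s :
  central_eval (int_central_poly R ('X^2 - 1)) s = s ^+ 2 - 1.
Proof.
rewrite (@central_eval_widen _ 3) => [|]; last first.
  by rewrite (leq_trans (size_polyD _ _)) // geq_max size_polyXn size_polyN size_poly1.
rewrite !big_ord_recl big_ord0 /= !coefB !coefXn !coef1 /=.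
by rewrite !subr0 sub0r mulr0z mulrNz mulr1z mul0r mul1r add0r addr0 expr0 mulr1 addrC.
Qed.

End Evaluation.

Section RootClean.
Variable R : pzRingType.
Implicit Types (c d k r s u v : R) (P Q : R -> Prop).

(** Strong cleanness with respect to an arbitrary predicate [P] on the summand
    [s] that accompanies the unit; in use, [s] is a root of a quadratic. *)
Definition root_clean P : Prop :=
  forall r, exists s u, [/\ r = s + u, P s, is_unit u & GRing.comm s u].

Lemma root_clean_iff P Q : (forall s, P s <-> Q s) ->
  root_clean P <-> root_clean Q.
Proof.
by move=> PQ; split=> clean r; have [s [u [-> /PQ Ps uU su]]] := clean r;
  exists s, u.
Qed.

(** A decomposition of [k * (r - d)], with [k] the inverse of [c], is carried
    by [s |-> c * s + d] to a decomposition of [r]. *)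
Lemma root_clean_affine P Q c d :
  is_unit c -> is_central c -> is_central d ->
  (forall s, P s -> Q (c * s + d)) -> root_clean P -> root_clean Q.
Proof.
move=> cU cC dC PQ clean r; have [k [_ ck]] := cU.
have [s [u [krd Ps uU su]]] := clean (k * (r - d)).
exists (c * s + d), (c * u); split.
- by rewrite addrAC -mulrDr -krd mulrA ck mul1r subrK.
- exact: PQ.
- exact: is_unit_mul.
have cu_s : GRing.comm (c * u) s.
  by apply/commr_sym/commrM=> //; apply/commr_sym/cC.
apply/commr_sym/commrD; last exact/commr_sym/dC.
by apply: commrM=> //; apply/commr_sym/cC.
Qed.

(** The decomposition of [0] makes [2 ^+ n] a unit. *)
Lemma unit2_of_exp2_clean n : (0 < n)%N ->
  root_clean (fun s => s ^+ 2 = 2%:R ^+ n * s) -> is_unit (2%:R : R).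
Proof.
move=> n_gt0 clean; have [s [u [/esym/eqP su s2 uU _]]] := clean 0.
have sU : is_unit s.
  by move: su; rewrite addr_eq0 => /eqP->; apply: is_unit_opp.
apply: (is_unit_expr_gt0 _ _ n n_gt0).
suff <- : s = 2%:R ^+ n by [].
apply: (is_unit_mulI _ s) => //.
by rewrite -expr2 s2; apply/is_central_expr/is_central_nat.
Qed.

(** The unit in the decomposition of [1] is [2] itself. *)
Lemma unit2_of_sqr1_clean :
  root_clean (fun s => s ^+ 2 = 1) -> is_unit (2%:R : R).
Proof.
move=> clean; have [s [u [one_su s2 uU _]]] := clean 1.
have uE : u = 1 - s by rewrite one_su addrAC subrr add0r.
suff sE : s = -1 by move: uU; rewrite uE sE opprK -mulr2n.
apply/eqP; rewrite -addr_eq0; apply/eqP/(is_unit_mulI _ u) => //.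
by rewrite mulr0 uE mulrDr mulr1 mulrBl mul1r -expr2 s2 addrA subrK subrr.
Qed.

Lemma sqr1_clean_of_exp2_clean n : (0 < n)%N ->
  root_clean (fun s => s ^+ 2 = 2%:R ^+ n * s) ->
  root_clean (fun s => s ^+ 2 = 1).
Proof.
move=> n_gt0 clean; have [h [h2 hr2]] := unit2_of_exp2_clean n n_gt0 clean.
case: n n_gt0 clean => // m _.
have hC : is_central h by apply: is_central_inv h2 hr2 (is_central_nat _ _).
have kq : h ^+ m * 2%:R ^+ m = 1 by rewrite -exprMn_comm ?h2 ?expr1n //; apply: hC.
have qk : 2%:R ^+ m * h ^+ m = 1 by rewrite -(is_central_expr _ _ m hC).
(* The scaling by [h ^+ m = 2 ^- m] gives [t ^+ 2 = t *+ 2], which is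
   [(t - 1) ^+ 2 = 1]. *)
apply: (root_clean_affine _ _ (h ^+ m) (-1)).
- by exists (2%:R ^+ m).
- exact: is_central_expr.
- exact/is_central_opp/(is_central_nat _ 1).
move=> s s2; rewrite sqr_affine; last 2 first.
- exact: is_central_expr.
- exact/is_central_opp/(is_central_nat _ 1).
rewrite s2 mulr_exp2 mulrnAr (expr2 (h ^+ m)) -mulrA (mulrA (h ^+ m) (2%:R ^+ m)).
by rewrite kq mul1r !mulN1r mulNr mulNrn subrr add0r sqrrN expr1n.
Qed.

(** The substitution is [s |-> (s + 1) / 2]. *)
Lemma strongly_clean_of_sqr1_clean :
  root_clean (fun s => s ^+ 2 = 1) -> strongly_clean R.
Proof.
move=> clean; have [h [h2 hr2]] := unit2_of_sqr1_clean clean.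
have hC : is_central h by apply: is_central_inv h2 hr2 (is_central_nat _ _).
apply: (root_clean_affine _ (fun e => e ^+ 2 = e) h h) clean => //.
  by exists 2%:R.
have hh : h ^+ 2 *+ 2 = h by rewrite expr2 -mulrnAr -mulr_natr h2 mulr1.
move=> s s2; rewrite sqr_affine // s2 mulr1 -expr2 -mulrnAl hh.
by rewrite addrAC -mulr2n hh addrC.
Qed.

(** The substitution is [e |-> 2 * e - 1]. *)
Lemma sqr1_clean_of_strongly_clean : is_unit (2%:R : R) ->
  strongly_clean R -> root_clean (fun s => s ^+ 2 = 1).
Proof.
move=> two_unit.
apply: (root_clean_affine (fun e => e ^+ 2 = e) _ 2%:R (-1)) => //.
- exact: is_central_nat.
- exact/is_central_opp/(is_central_nat _ 1).
move=> e e2; rewrite sqr_affine; last 2 first.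
- exact: is_central_nat.
- exact/is_central_opp/(is_central_nat _ 1).
rewrite e2 mulN1r mulNr mulNrn expr2 -mulrA mulr_natl subrr add0r.
by rewrite sqrrN expr1n.
Qed.

(** The substitution is [v |-> 2 ^+ n.-1 * (v + 1)]. *)
Lemma exp2_clean_of_sqr1_clean n : (0 < n)%N ->
  root_clean (fun s => s ^+ 2 = 1) ->
  root_clean (fun s => s ^+ 2 = 2%:R ^+ n * s).
Proof.
case: n => // m _ clean; have [h [h2 hr2]] := unit2_of_sqr1_clean clean.
have qC : is_central (2%:R ^+ m : R) by apply/is_central_expr/is_central_nat.
have h2C : GRing.comm h 2%:R by rewrite /GRing.comm h2 hr2.
apply: (root_clean_affine _ _ (2%:R ^+ m) (2%:R ^+ m)) clean => //.
  by exists (h ^+ m); split; rewrite -exprMn_comm ?h2 ?hr2 ?expr1n.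
move=> s s2; rewrite sqr_affine // s2 mulr1 mulr_exp2 mulrDr !mulrA -!expr2.
by rewrite addrAC -mulr2n mulrnDl addrC.
Qed.

End RootClean.

Theorem theorem4p1 (R : pzRingType) (n : nat) (hn : (0 < n)%N) :
  [<-> strongly_poly_clean (int_central_poly R ('X^2 - (2 ^+ n) *: 'X));
       strongly_poly_clean (int_central_poly R ('X^2 - 1));
       strongly_clean R /\ is_unit (2%:R : R);
       (forall a : R, sum_of_units_le 2 a) /\
       (forall a : R, exists u v : R,
          [/\ a = u + v, is_unit u, is_unit v, GRing.comm u v & v ^+ 2 = 1])].
Proof.
have exp2P : strongly_poly_clean (int_central_poly R ('X^2 - (2 ^+ n) *: 'X))
    <-> root_clean R (fun s => s ^+ 2 = 2%:R ^+ n * s).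
  apply: root_clean_iff => s; rewrite central_eval_X2_sub_exp2X.
  by split=> [/subr0_eq | ->]; rewrite ?subrr.
have sqr1P : strongly_poly_clean (int_central_poly R ('X^2 - 1))
    <-> root_clean R (fun s => s ^+ 2 = 1).
  apply: root_clean_iff => s; rewrite central_eval_X2_sub1.
  by split=> [/subr0_eq | ->]; rewrite ?subrr.
tfae.
- move=> /exp2P clean; apply/sqr1P.
  exact: sqr1_clean_of_exp2_clean clean.
- move/sqr1P=> clean; split; first exact: strongly_clean_of_sqr1_clean.
  exact: unit2_of_sqr1_clean.
- case=> clean two_unit.
  have {}clean := sqr1_clean_of_strongly_clean R two_unit clean.
  split=> a; have [v [u [-> v2 uU vu]]] := clean a.
    exists [:: v; u]; split=> //; last by rewrite big_cons big_seq1.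
    by move=> w; rewrite !inE => /orP[] /eqP-> //; apply: is_unit_sqr1.
  by exists u, v; split=> //; [rewrite addrC | apply: is_unit_sqr1].
- case=> _ decomp; apply/exp2P/exp2_clean_of_sqr1_clean=> // r.
  have [u [v [-> uU _ uv v2]]] := decomp r.
  by exists v, u; split=> //; rewrite addrC.
Qed.
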